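(* Let $\alpha\in(0,1)$ and let $\widehat{\mathcal C^{\rm full}_{(1-\alpha)}}(X_{T+1})=\{y\in\mathbb R:\hat p(y)>\alpha\}$ be the full distributional conformal prediction set defined in the context. Suppose that there exists a non-random function $F^*(\cdot,\cdot)$ such that, with $V_t:=\psi(F^*(Y_t,X_t))$ and $\hat V_t:=\hat V_t^{(Y_{T+1})}=\psi(\hat F^{(Y_{T+1})}(Y_t,X_t))$ for $1\le t\le T+1$, the following hold as $T\to\infty$: 1. There exists a strictly increasing continuous function $\phi:[0,\infty)\to[0,\infty)$ with $\phi(0)=0$ such that $(T+1)^{-1}\sum_{t=1}^{T+1}\phi(|\hat V_t-V_t|)=o_P(1)$, and $\hat V_{T+1}=V_{T+1}+o_P(1)$. 2. $\sup_{v\in\mathbb R}|\tilde G(v)-G(v)|=o_P(1)$, where $\tilde G(v)=(T+1)^{-1}\sum_{t=1}^{T+1}\mathbf 1\{V_t<v\}$ and $G$ is the distribution function of $V_{T+1}$. 3. $\sup_{x_1\ne x_2}|G(x_1)-G(x_2)|/|x_1-x_2|$ is bounded (uniformly in $T$). Then, as $T\to\infty$, $$P\left(Y_{T+1}\in\widehat{\mathcal C^{\rm full}_{(1-\alpha)}}(X_{T+1})\right)=1-\alpha+o(1).$$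
   Context: For each $T$, the data are random pairs $(Y_t,X_t)$, $1\le t\le T+1$, with $Y_t$ real-valued and $X_t$ a vector of predictors (not assumed independent or exchangeable). $F(y,x)=P(Y_t\le y\mid X_t=x)$ is the conditional distribution function (the same for all $t$), and $F(\cdot,X_t)$ is continuous almost surely. $\psi$ is a fixed deterministic (measurable) real-valued function, e.g. $\psi(u)=|u-1/2|$. For each $y\in\mathbb R$, the augmented data set is $Z^{(y)}=\{Z^{(y)}_t\}_{t=1}^{T+1}$ with $Z_t^{(y)}=(Y_t,X_t)$ for $1\le t\le T$ and $Z^{(y)}_{T+1}=(y,X_{T+1})$. $\hat F^{(y)}$ is an estimator of $F$ computed from $Z^{(y)}$ (any estimator, with $\hat F^{(y)}(\cdot,x)$ monotone). Set $\hat U_t^{(y)}=\hat F^{(y)}(Y_t,X_t)$ for $t\le T$, $\hat U^{(y)}_{T+1}=\hat F^{(y)}(y,X_{T+1})$, $\hat V_t^{(y)}=\psi(\hat U_t^{(y)})$, and $$\hat p(y)=\frac1{T+1}\sum_{t=1}^{T+1}\mathbf 1\{\hat V_t^{(y)}\ge\hat V_{T+1}^{(y)}\}.$$ *)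

(* Defs.v *)
From mathcomp Require Export all_boot all_order all_algebra.
From mathcomp Require Export all_classical all_reals all_analysis.
Set Implicit Arguments.
Unset Strict Implicit.
Unset Printing Implicit Defensive.
Export Order.TTheory GRing.Theory Num.Theory.
Export numFieldNormedType.Exports.
Local Open Scope classical_set_scope.
Local Open Scope ring_scope.

(* W_T = o_P(1) as T -> oo, where W_T lives on its own probability space. *)
Definition oP (R : realType) (d : nat -> measure_display)
    (Omega : forall T, measurableType (d T))
    (P : forall T, probability (Omega T) R)
    (W : forall T, Omega T -> R) : Prop :=
  forall e : R, 0 < e ->
    (fun T => P T [set w | e < `|W T w|]) @ \oo --> 0%E.

(* F(y, x) = P(Y <= y | X = x), in its regular version: F(., x) is a
   distribution function for every x, and F(y, X) is a version of the
   conditional probability of {Y <= y} given X. *)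
Definition is_cond_cdf (R : realType) (d : measure_display)
    (Omega : measurableType d) (P : probability Omega R) (p : nat)
    (Y : {RV P >-> R}) (X : {RV P >-> p.-tuple R})
    (F : R -> p.-tuple R -> R) : Prop :=
  [/\ forall x, [/\ {homo F^~ x : y1 y2 / y1 <= y2},
        right_continuous (F^~ x),
        F y x @[y --> -oo] --> (0 : R) & F y x @[y --> +oo] --> (1 : R)],
      forall y, measurable_fun [set: p.-tuple R] (F y)
    & forall (y : R) (B : set (p.-tuple R)), measurable B ->
        P ([set w | Y w <= y] `&` X @^-1` B)
        = (\int[P]_(w in X @^-1` B) (F y (X w))%:E)%E].

(* The times 1, ..., T+1 are the ordinals 0, ..., T, so that T+1 is ord_max. *)
Definition dataset (R : realType) (p T : nat) : Type :=
  T.+1.-tuple (R * p.-tuple R).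

(* Z^(y); the value of Y at ord_max is not used. *)
Definition augment (R : realType) (p T : nat) (Y : 'I_T.+1 -> R)
    (X : 'I_T.+1 -> p.-tuple R) (y : R) : dataset R p T :=
  [tuple (if t == ord_max then y else Y t, X t) | t < T.+1].

(* An estimator maps a data set Z to a function (y, x) |-> Fhat(y, x),
   measurably in (Z, y, x) so that all derived quantities are random
   variables. *)
Definition is_estimator (R : realType) (p T : nat)
    (E : dataset R p T -> R -> p.-tuple R -> R) : Prop :=
  (forall z x, {homo (E z)^~ x : y1 y2 / y1 <= y2}) /\
  measurable_fun [set: T.+1.-tuple (R * p.-tuple R) * (R * p.-tuple R)]
    (fun q => E q.1 q.2.1 q.2.2).

(* Vhat_t = psi (Fhat (Z_t)), with Fhat computed from Z itself. *)
Definition score (R : realType) (p T : nat) (psi : R -> R)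
    (E : dataset R p T -> R -> p.-tuple R -> R) (Z : dataset R p T)
    (t : 'I_T.+1) : R :=
  psi (E Z (tnth Z t).1 (tnth Z t).2).

Definition p_value (R : realType) (p T : nat) (psi : R -> R)
    (E : dataset R p T -> R -> p.-tuple R -> R) (Z : dataset R p T) : R :=
  T.+1%:R^-1 *
  \sum_(t < T.+1) (score psi E Z ord_max <= score psi E Z t)%R%:R.

Definition full_conformal_set (R : realType) (p T : nat) (alpha : R)
    (psi : R -> R) (E : dataset R p T -> R -> p.-tuple R -> R)
    (Y : 'I_T.+1 -> R) (X : 'I_T.+1 -> p.-tuple R) : set R :=
  [set y | alpha < p_value psi E (augment Y X y)].

(* Gtilde uses strict inequalities, hence is left-continuous in v. *)
Definition emp_cdf (R : realType) (T : nat) (V : 'I_T.+1 -> R) (v : R) : R :=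
  T.+1%:R^-1 * \sum_(t < T.+1) (V t < v)%R%:R.

(* Real-valued counterpart of cdf for an unbundled function V. *)
Definition dist_fun (R : realType) (d : measure_display)
    (Omega : measurableType d) (P : probability Omega R) (V : Omega -> R)
    (v : R) : R :=
  fine (P [set w | V w <= v]).

(* Main.v *)
(* Let Ghat be the left-continuous empirical distribution function of the
   Vhat_t, so that Y_{T+1} lies in the conformal set iff
   Ghat(Vhat_{T+1}) < 1 - alpha.  If at most a fraction h of the indices satisfy
   |Vhat_t - V_t| > c, then Ghat(v) lies between Gtilde(v - c) - h and
   Gtilde(v + c) + h; the first hypothesis gives such an h by Markov's inequality
   for phi.  Hence, off an event of vanishing probability,
   |Ghat(Vhat_{T+1}) - G(V_{T+1})| <= e by the other hypotheses.  Since G is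
   continuous, it attains 1 - alpha - 2e and 1 - alpha + e, which traps
   P(Ghat(Vhat_{T+1}) < 1 - alpha) between these two values up to o(1). *)
From mathcomp Require Import ring lra measurable_realfun.
Require Import Defs.
Set Implicit Arguments.
Unset Strict Implicit.
Unset Printing Implicit Defensive.
Local Open Scope classical_set_scope.
Local Open Scope ring_scope.

(** * Deterministic bounds on empirical distribution functions *)

Lemma emp_cdf_ge0 (R : realType) (T : nat) (V : 'I_T.+1 -> R) (v : R) :
  0 <= emp_cdf V v.
Proof. by rewrite mulr_ge0 ?invr_ge0 ?ler0n// sumr_ge0. Qed.

Lemma emp_cdf_le1 (R : realType) (T : nat) (V : 'I_T.+1 -> R) (v : R) :
  emp_cdf V v <= 1.
Proof.
rewrite /emp_cdf ler_pdivrMl ?ltr0n// mulr1.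
rewrite (le_trans (ler_sum _ (G := fun=> 1) _)) => [//|t _|].
  by case: (_ < _) => /=.
by rewrite sumr_const card_ord.
Qed.

(** An index with [W t < v] either has [V t < v + c] or has moved by more than [c], so the
    inequality holds term by term. *)
Lemma emp_cdf_perturb (R : realType) (T : nat) (V W : 'I_T.+1 -> R)
    (c v : R) :
  emp_cdf W v <= emp_cdf V (v + c) +
    T.+1%:R^-1 * \sum_(t < T.+1) (c < `|W t - V t|)%R%:R.
Proof.
rewrite -mulrDr ler_wpM2l ?invr_ge0// -big_split ler_sum// => t _ /=.
have [Wv|_] := ltP (W t) v; last by rewrite addr_ge0.
have [Vv|vV] := ltP (V t) (v + c); first by rewrite lerDl.
by rewrite distrC (lt_le_trans _ (ler_norm _)) ?addr0 ?add0r//; lra.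
Qed.

(** Markov's inequality for the uniform measure on the indices: monotonicity makes
    [phi |a t| / phi c] at least 1 where [c < |a t|], and it is nonnegative elsewhere. *)
Lemma markov_mean (R : realType) (T : nat) (phi : R -> R)
    (a : 'I_T.+1 -> R) (c : R) :
  {in `[0, +oo[ &, {homo phi : a b / a < b}} ->
  (forall x, 0 <= x -> 0 <= phi x) -> 0 < c -> 0 < phi c ->
  T.+1%:R^-1 * \sum_(t < T.+1) (c < `|a t|)%R%:R <=
  (T.+1%:R^-1 * \sum_(t < T.+1) phi `|a t|) / phi c.
Proof.
move=> phi_incr phi_ge0 c0 phic0.
rewrite -mulrA ler_wpM2l ?invr_ge0// mulr_suml ler_sum// => t _.
have [ca|_] := ltP c `|a t|; last by apply: divr_ge0; [exact: phi_ge0|exact: ltW].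
by rewrite [leLHS]mulr1n ler_pdivlMr// mul1r ltW// phi_incr// in_itv/= ?normr_ge0 ?(ltW c0).
Qed.

(** The indicators of [<=] and of the reversed [<] add up to 1; the strict inequality in [emp_cdf]
    makes this exact even with ties. *)
Lemma p_valueE (R : realType) (p T : nat) (psi : R -> R)
    (E : dataset R p T -> R -> p.-tuple R -> R) (Z : dataset R p T) :
  p_value psi E Z = 1 - emp_cdf (score psi E Z) (score psi E Z ord_max).
Proof.
apply/eqP; rewrite -subr_eq opprK -mulrDr -big_split/=.
rewrite (eq_bigr (fun=> 1)) => [|t _].
  by rewrite sumr_const card_ord mulVf// pnatr_eq0.
by rewrite ltNge; case: (_ <= _); rewrite ?addr0 ?add0r.
Qed.

Lemma emp_cdf_close (R : realType) (T : nat) (V W : 'I_T.+1 -> R)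
    (G : R -> R) (L c e h : R) :
  (forall x y, `|G x - G y| <= L * `|x - y|) -> 0 <= L -> 0 <= c ->
  (forall v, `|emp_cdf V v - G v| <= e) ->
  T.+1%:R^-1 * \sum_(t < T.+1) (c < `|W t - V t|)%R%:R <= h ->
  `|W ord_max - V ord_max| <= c ->
  `|emp_cdf W (W ord_max) - G (V ord_max)| <= 2 * L * c + e + h.
Proof.
move=> GL L0 c0 VG Wh Wc.
set w := W ord_max in Wc *; set v := V ord_max in Wc *.
have up : emp_cdf W w <= emp_cdf V (w + c) + h.
  by apply: le_trans (emp_cdf_perturb V W c w) _; rewrite lerD2l.
(* Same perturbation bound with the roles of [V] and [W] exchanged, started at [w - c] so that the
   shift by [c] lands on [w]. *)
have lo : emp_cdf V (w - c) <= emp_cdf W w + h.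
  apply: le_trans (emp_cdf_perturb W V c (w - c)) _.
  by rewrite subrK lerD2l; under eq_bigr do rewrite distrC.
(* The evaluation points [w + c] and [w - c] are within [2 * c] of [v]: one [c] from the shift, one
   from [Wc]. *)
have G2 x : `|x - v| <= 2 * c -> `|G x - G v| <= 2 * L * c.
  move=> xv; apply: (le_trans (GL _ _)).
  by rewrite (mulrC 2) -mulrA ler_wpM2l.
move: Wc; rewrite ler_norml => /andP[Wc1 Wc2].
have /G2 : `|w + c - v| <= 2 * c by rewrite ler_norml; apply/andP; split; lra.
have /G2 : `|w - c - v| <= 2 * c by rewrite ler_norml; apply/andP; split; lra.
have := VG (w + c); have := VG (w - c).
rewrite !ler_norml => /andP[? ?] /andP[? ?] /andP[? ?] /andP[? ?].
by apply/andP; split; lra.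
Qed.

(** * Monotonicity, range and continuity of distribution functions *)

Lemma dist_fun_ge0 (R : realType) (d : measure_display)
    (Omega : measurableType d) (P : probability Omega R) (V : Omega -> R)
    (v : R) : 0 <= dist_fun P V v.
Proof. by rewrite fine_ge0. Qed.

Lemma measurable_le_cst (R : realType) (d : measure_display)
    (Omega : measurableType d) (V : Omega -> R) (v : R) :
  measurable_fun [set: Omega] V -> measurable [set w | V w <= v].
Proof.
move=> mV; rewrite -[X in measurable X]setTI.
by have := mV measurableT _ (measurable_itv `]-oo, v]); rewrite set_itvE.
Qed.

Lemma measurable_lt_cst (R : realType) (d : measure_display)
    (Omega : measurableType d) (V : Omega -> R) (v : R) :
  measurable_fun [set: Omega] V -> measurable [set w | v < V w].
Proof.
move=> mV; rewrite -[X in measurable X]setTI.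
by have := mV measurableT _ (measurable_itv `]v, +oo[); rewrite set_itvE.
Qed.

Lemma dist_funE (R : realType) (d : measure_display)
    (Omega : measurableType d) (P : probability Omega R) (V : Omega -> R)
    (v : R) : measurable_fun [set: Omega] V ->
  P [set w | V w <= v] = (dist_fun P V v)%:E.
Proof.
by move=> mV; rewrite fineK// fin_num_measure//; exact: measurable_le_cst.
Qed.

Lemma dist_fun_le1 (R : realType) (d : measure_display)
    (Omega : measurableType d) (P : probability Omega R) (V : Omega -> R)
    (v : R) : measurable_fun [set: Omega] V -> dist_fun P V v <= 1.
Proof.
move=> mV; rewrite -lee_fin -dist_funE// probability_le1//.
exact: measurable_le_cst.
Qed.

Lemma dist_fun_homo (R : realType) (d : measure_display)
    (Omega : measurableType d) (P : probability Omega R) (V : Omega -> R) :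
  measurable_fun [set: Omega] V ->
  {homo dist_fun P V : x y / x <= y}.
Proof.
move=> mV x y xy; rewrite -lee_fin -!dist_funE//.
apply: le_measure; rewrite ?inE; try exact: measurable_le_cst.
by move=> w /= /le_trans; apply.
Qed.

(** Intermediate value theorem between the limits 0 and 1 at infinity. These limits need not be
    attained, hence the strict bounds on [u]. *)
Lemma dist_fun_surj (R : realType) (d : measure_display)
    (Omega : measurableType d) (P : probability Omega R) (V : Omega -> R)
    (u : R) :
  measurable_fun [set: Omega] V -> continuous (dist_fun P V) ->
  0 < u < 1 -> exists v, dist_fun P V v = u.
Proof.
move=> mV cG /andP[u0 u1]; set G := dist_fun P V.
pose X : {RV P >-> R} := mfun_Sub (mem_set mV).
have GE x : cdf X x = (G x)%:E.
  by rewrite -dist_funE// /cdf /distribution/= /pushforward/= set_itvE.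
have /fine_cvgP[_ G1] : (G x)%:E @[x --> +oo] --> 1%:E.
  by rewrite -(funext GE); exact: cvg_cdfy1.
have /fine_cvgP[_ G0] : (G x)%:E @[x --> -oo] --> 0%:E.
  by rewrite -(funext GE); exact: cvg_cdfNy0.
have [b ub] : exists b, u < G b.
  near (+oo : set_system R) => b; exists b.
  by near: b; move/cvgr_gt : G1; apply.
have [a ua] : exists a, G a < u.
  near (-oo : set_system R) => a; exists a.
  by near: a; move/cvgr_lt : G0; apply.
have ab : a <= b.
  rewrite leNgt; apply/negP => /ltW /(dist_fun_homo P mV).
  by apply/negP; rewrite -ltNge (lt_trans ua).
have [||c _ <-] := @IVT R G a b u ab; last by exists c.
  exact: continuous_subspaceT.
by rewrite ge_min le_max (ltW ua) (ltW ub) orbT.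
Unshelve. all: by end_near. Qed.

Lemma lipschitz_cst_continuous (R : realType) (G : R -> R) (L : R) :
  (forall x y, `|G x - G y| <= L * `|x - y|) -> continuous G.
Proof.
move=> GL x; have L0 : 0 <= L.
  have := GL 1 0; rewrite subr0 normr1 mulr1; exact: le_trans.
apply/cvgrPdist_lt => e e0; near=> y.
apply: (le_lt_trans (GL x y)).
(* Passing to [L + 1] keeps the divisor positive when [L = 0]. *)
rewrite (@le_lt_trans _ _ ((L + 1) * `|x - y|))//.
  by rewrite ler_wpM2r// lerDl.
rewrite mulrC -ltr_pdivlMr ?ltr_wpDl//; near: y.
by apply: (nbhsx_ballx x (e / (L + 1))); rewrite divr_gt0// ltr_wpDl.
Unshelve. all: by end_near. Qed.

(** * Measurability of empirical distribution functions, their suprema and the scores *)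

Lemma measurable_fun_nat_of_bool (R : realType) (d : measure_display)
    (Omega : measurableType d) (b : Omega -> bool) :
  measurable_fun [set: Omega] b ->
  measurable_fun [set: Omega] (fun w => (b w)%:R : R).
Proof.
move=> mb; rewrite (_ : (fun w => _) = fun w => if b w then 1 else 0).
  by apply: measurable_fun_ifT => //; exact: measurable_cst.
by apply/funext => w; case: (b w).
Qed.

Lemma measurable_emp_cdf (R : realType) (d : measure_display)
    (Omega : measurableType d) (T : nat) (V : 'I_T.+1 -> Omega -> R)
    (v : Omega -> R) :
  (forall t, measurable_fun [set: Omega] (V t)) ->
  measurable_fun [set: Omega] v ->
  measurable_fun [set: Omega] (fun w => emp_cdf (V ^~ w) (v w)).
Proof.
move=> mV mv; apply: measurable_funM; first exact: measurable_cst.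
apply: measurable_sum => t; apply: measurable_fun_nat_of_bool.
exact: measurable_fun_ltr.
Qed.

(** No sample value lies strictly between [v] and the largest one below it, so no count changes
    there. The default [v - 1] covers the case where no sample value is below [v]. *)
Lemma emp_cdf_left (R : realType) (T : nat) (V : 'I_T.+1 -> R) (v : R) :
  exists2 m, m < v & forall u, m < u -> u <= v -> emp_cdf V u = emp_cdf V v.
Proof.
exists (\big[Num.max/v - 1]_(t | V t < v) V t).
  by apply/bigmax_ltP; split => //; rewrite gtrBl.
move=> u mu uv; congr (_ * _); apply: eq_bigr => t _; congr (_%:R).
congr nat_of_bool; have [Vv|vV] := ltP (V t) v.
  by rewrite (le_lt_trans _ mu)// (le_bigmax_cond _ _ Vv).
by apply/negbTE; rewrite -leNgt (le_trans uv).
Qed.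

Lemma has_sup_emp_cdf_dist (R : realType) (T : nat) (V : 'I_T.+1 -> R)
    (G : R -> R) :
  (forall v, 0 <= G v <= 1) ->
  has_sup [set `|emp_cdf V v - G v| | v in [set: R]].
Proof.
move=> G01; split; first by exists `|emp_cdf V 0 - G 0|, 0.
exists 1 => _ [v _ <-]; have /andP[? ?] := G01 v.
have := emp_cdf_ge0 V v; have := emp_cdf_le1 V v.
by rewrite ler_norml => ? ?; apply/andP; split; lra.
Qed.

Lemma sup_emp_cdf_dist_ge (R : realType) (T : nat) (V : 'I_T.+1 -> R)
    (G : R -> R) (v : R) :
  (forall v, 0 <= G v <= 1) ->
  `|emp_cdf V v - G v| <=
    `|sup [set `|emp_cdf V v - G v| | v in [set: R]]|.
Proof.
move=> G01; apply: le_trans (ler_norm _).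
by apply: ub_le_sup; [exact: (has_sup_emp_cdf_dist V G01).2|exists v].
Qed.

(* Since [emp_cdf V] is left-continuous and [G] continuous, the supremum is
   unchanged when [v] is restricted to the rationals. *)
Lemma measurable_sup_emp_cdf_dist (R : realType) (d : measure_display)
    (Omega : measurableType d) (T : nat) (V : 'I_T.+1 -> Omega -> R)
    (G : R -> R) (e : R) :
  (forall t, measurable_fun [set: Omega] (V t)) ->
  continuous G -> (forall v, 0 <= G v <= 1) ->
  measurable [set w | e <
    `|sup [set `|emp_cdf (V ^~ w) v - G v| | v in [set: R]]|].
Proof.
move=> mV cG G01.
pose D (q : rat) := [set w | e < `|emp_cdf (V ^~ w) (ratr q) - G (ratr q)|].
rewrite (_ : [set w | _] = \bigcup_q D q).
  apply: bigcupT_measurable_rat => q; apply: measurable_lt_cst.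
  apply: measurableT_comp; first exact: normr_measurable.
  apply: measurable_funB; last exact: measurable_cst.
  by apply: measurable_emp_cdf => //; exact: measurable_cst.
apply/seteqP; split => [w /= | w [q _] /lt_le_trans]; last first.
  by apply; exact: sup_emp_cdf_dist_ge.
have S := has_sup_emp_cdf_dist (V ^~ w) G01.
rewrite ger0_norm => [/(sup_gt S.1)[_ [v _ <-] ev]|]; last first.
  apply: le_trans (normr_ge0 (emp_cdf (V ^~ w) 0 - G 0)) _.
  by apply: ub_le_sup; [exact: S.2|exists 0].
have [m mv mV'] := emp_cdf_left (V ^~ w) v.
(* With the empirical term frozen at its value at [v], continuity of [G] keeps the deviation above
   [e] on a left neighbourhood of [v]; a rational to the right of both [m] and [m'] then serves. *)
have [m' m'v Gm'] : exists2 m', m' < v & forall u, m' < u -> u <= v ->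
    e < `|emp_cdf (V ^~ w) v - G u|.
  have : `|emp_cdf (V ^~ w) v - G u| @[u --> v] -->
      `|emp_cdf (V ^~ w) v - G v|.
    by apply: cvg_norm; apply: cvgB; [exact: cvg_cst|exact: cG].
  move/cvgr_gt => /(_ _ ev)[r /= r0 rP]; exists (v - r); first by rewrite gtrBl.
  move=> u ru uv; apply: rP => /=.
  by rewrite ger0_norm ?subr_ge0// ltrBlDr -ltrBlDl.
have [q] : exists q, ratr q \in `](Num.max m m'), v[.
  by apply: rat_in_itvoo; rewrite gt_max mv.
rewrite in_itv/= gt_max => /andP[/andP[mq m'q] qv].
by exists q => //; rewrite /D /= mV' ?(ltW qv)// Gm' ?(ltW qv).
Qed.

Lemma measurable_score (R : realType) (d : measure_display)
    (Omega : measurableType d) (p T : nat) (psi : R -> R)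
    (E : dataset R p T -> R -> p.-tuple R -> R) (Z : Omega -> dataset R p T)
    (t : 'I_T.+1) :
  measurable_fun [set: R] psi -> is_estimator E ->
  measurable_fun [set: Omega] (Z : Omega -> T.+1.-tuple (R * p.-tuple R)) ->
  measurable_fun [set: Omega] (fun w => score psi E (Z w) t).
Proof.
move=> mpsi [_ mE] mZ; apply: (measurableT_comp mpsi).
have mZt : measurable_fun [set: Omega] (fun w => (Z w, tnth (Z w) t)
    : T.+1.-tuple (R * p.-tuple R) * (R * p.-tuple R)).
  by apply: measurable_fun_pair => //; exact: (measurable_fun_tnthP _).1.
exact: (measurableT_comp mE mZt).
Qed.

(** The inserted value [y] is random because the conformal set is tested at the random point
    [Y T ord_max w]. *)
Lemma measurable_augment (R : realType) (d : measure_display)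
    (Omega : measurableType d) (p T : nat) (Y : 'I_T.+1 -> Omega -> R)
    (X : 'I_T.+1 -> Omega -> p.-tuple R) (y : Omega -> R) :
  (forall t, measurable_fun [set: Omega] (Y t)) ->
  (forall t, measurable_fun [set: Omega] (X t)) ->
  measurable_fun [set: Omega] y ->
  measurable_fun [set: Omega] (fun w => augment (Y ^~ w) (X ^~ w) (y w)
    : T.+1.-tuple (R * p.-tuple R)).
Proof.
move=> mY mX my; apply/measurable_fun_tnthP => t.
rewrite (_ : _ \o _ = fun w => (if t == ord_max then y w else Y t w, X t w)).
  by apply: measurable_fun_pair; [case: (t == ord_max)|exact: mX].
by apply/funext => w /=; rewrite tnth_mktuple.
Qed.

(** * From uniform closeness off a small event to limits of probabilities *)

Lemma probability_approx (R : realType) (d : measure_display)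
    (Omega : measurableType d) (P : probability Omega R) (V W : Omega -> R)
    (B : set Omega) (u e : R) :
  measurable_fun [set: Omega] V -> measurable_fun [set: Omega] W ->
  measurable B -> continuous (dist_fun P V) -> 0 < e ->
  0 < u - 2 * e -> u + e < 1 ->
  (forall w, ~ B w -> `|W w - dist_fun P V (V w)| <= e) ->
  ((u - 2 * e)%:E <= P [set w | (W w < u)%R] + P B)%E /\
  (P [set w | (W w < u)%R] <= (u + e)%:E + P B)%E.
Proof.
move=> mV mW mB cG e0 ue1 ue2 WG.
have mA : measurable [set w | W w < u].
  rewrite (_ : [set w | _] = ~` [set w | u <= W w]); last first.
    by apply/seteqP; split => w /=;
      [rewrite ltNge => /negP|move/negP; rewrite -ltNge].
  apply: measurableC; rewrite -[X in measurable X]setTI.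
  by have := mW measurableT _ (measurable_itv `[u, +oo[); rewrite set_itvE.
(* Off [B], [V w <= v] gives [W w <= u - e], hence the strict [W w < u]; the level [u - e] would
   only give [W w <= u]. Above, [W w < u] is already strict, so [u + e] suffices. *)
have [|v Gv] := dist_fun_surj (P := P) (u := u - 2 * e) mV cG.
  by apply/andP; split => //; lra.
have [|v' Gv'] := dist_fun_surj (P := P) (u := u + e) mV cG.
  by apply/andP; split => //; lra.
have mle x := measurable_le_cst x mV.
rewrite -Gv -Gv' -!dist_funE//; split.
  apply: le_trans (measureU2 _ mA mB); apply: le_measure; rewrite ?inE//.
    exact: measurableU.
  move=> w /= /(dist_fun_homo P mV) Vv; have [Bw|/WG] := pselect (B w).
    by right.
  by rewrite ler_norml => /andP[_ ?]; left => /=; lra.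
apply: le_trans (measureU2 _ (mle v') mB); apply: le_measure; rewrite ?inE//.
  exact: measurableU.
move=> w /= Wu; have [Bw|/WG] := pselect (B w); first by right.
rewrite ler_norml => /andP[? _]; left => /=; rewrite leNgt; apply/negP.
by move/ltW/(dist_fun_homo P mV); lra.
Qed.

(** For fixed [e] the error [b] is eventually below [e], which puts [a T] within [3 * e] of [u];
    then [e] is taken small. *)
Lemma cvg_probability_sandwich (R : realType) (a : nat -> \bar R) (u : R) :
  0 < u < 1 -> (forall T, 0 <= a T)%E ->
  (forall e, 0 < e -> 2 * e < u -> u + e < 1 -> exists2 b : nat -> \bar R,
     b @ \oo --> 0%E & forall T,
     ((u - 2 * e)%:E <= a T + b T)%E /\ (a T <= (u + e)%:E + b T)%E) ->
  a @ \oo --> u%:E.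
Proof.
move=> /andP[u0 u1] a0 H.
suff S e : 0 < e -> \forall T \near \oo,
    ((u - e)%:E <= a T)%E /\ (a T <= (u + e)%:E)%E.
  apply/fine_cvgP; split.
    (* A limit in the extended reals requires eventual finiteness, for which the tolerance 1 is
       enough. *)
    apply: filterS (S 1 ltr01) => T [_ aT].
    by rewrite ge0_fin_numE// (le_lt_trans aT) ?ltry.
  apply/cvgrPdist_le => e e0; apply: filterS (S e e0) => T [l r].
  have : a T \is a fin_num by rewrite ge0_fin_numE// (le_lt_trans r) ?ltry.
  move/fineK => aE; move: l r; rewrite -aE !lee_fin/= => ? ?.
  by rewrite ler_norml; apply/andP; split; lra.
(* [e / 3] absorbs the loss [2 * e'] plus the error [e']; the other two bounds ensure [2 * e' < u]
   and [u + e' < 1]. *)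
move=> e0; pose e' := Num.min (e / 3) (Num.min (u / 3) ((1 - u) / 2)).
have e'0 : 0 < e' by rewrite !lt_min !divr_gt0//; lra.
have e'e : e' <= e / 3 by rewrite ge_min lexx.
have e'u : e' <= u / 3 by rewrite !ge_min lexx orbT.
have e'u1 : e' <= (1 - u) / 2 by rewrite !ge_min lexx !orbT.
have [||b b0 ab] := H e' e'0; [lra|lra|].
have /fine_cvgP[bfin /cvgr_lt b0'] := b0.
near=> T.
have bT : b T \is a fin_num by near: T.
have xe : fine (b T) < e' by near: T; exact: b0'.
have := ab T; rewrite -(fineK bT) => -[l r].
have : a T \is a fin_num by rewrite ge0_fin_numE// (le_lt_trans r) ?ltry.
move/fineK => aE; move: l r; rewrite -aE -!EFinD !lee_fin => ? ?.
by split; lra.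
Unshelve. all: by end_near. Qed.

(** * Asymptotic coverage of the full conformal set *)

Theorem theorem2 (R : realType) (p : nat)
    (d : nat -> measure_display) (Omega : forall T : nat, measurableType (d T))
    (P : forall T : nat, probability (Omega T) R)
    (Y : forall T : nat, 'I_T.+1 -> {RV (P T) >-> R})
    (X : forall T : nat, 'I_T.+1 -> {RV (P T) >-> p.-tuple R})
    (F : nat -> R -> p.-tuple R -> R)
    (hF : forall (T : nat) (t : 'I_T.+1), is_cond_cdf (Y T t) (X T t) (F T))
    (hFcont : forall (T : nat) (t : 'I_T.+1),
      {ae P T, forall w, continuous (fun y : R => F T y (X T t w))})
    (psi : R -> R) (hpsi : measurable_fun [set: R] psi)
    (Fhat : forall T : nat, dataset R p T -> R -> p.-tuple R -> R)
    (hFhat : forall T : nat, is_estimator (Fhat T))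
    (alpha : R) (halpha : 0 < alpha < 1)
    (Fstar : R -> p.-tuple R -> R)
    (hFstar : measurable_fun [set: R * p.-tuple R] (fun z => Fstar z.1 z.2)) :
  let V (T : nat) (t : 'I_T.+1) (w : Omega T) : R :=
    psi (Fstar (Y T t w) (X T t w)) in
  let Vhat (T : nat) (t : 'I_T.+1) (w : Omega T) : R :=
    score psi (Fhat T)
      (augment (fun s => Y T s w) (fun s => X T s w) (Y T ord_max w)) t in
  let G (T : nat) : R -> R := dist_fun (P T) (V T ord_max) in
  (exists phi : R -> R,
     [/\ {in `[0, +oo[ &, {homo phi : a b / a < b}},
         {within `[0, +oo[, continuous phi},
         (forall a, 0 <= a -> 0 <= phi a),
         phi 0 = 0
       & oP P (fun T w =>
           T.+1%:R^-1 * \sum_(t < T.+1) phi `|Vhat T t w - V T t w|)]) ->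
  oP P (fun T w => Vhat T ord_max w - V T ord_max w) ->
  oP P (fun T w =>
    sup [set `|emp_cdf (fun t => V T t w) v - G T v| | v in [set: R]]) ->
  (exists L : R, forall (T : nat) (x1 x2 : R), x1 != x2 ->
     `|G T x1 - G T x2| / `|x1 - x2| <= L) ->
  (fun T => P T [set w |
     full_conformal_set alpha psi (Fhat T)
       (fun s => Y T s w) (fun s => X T s w) (Y T ord_max w)])
    @ \oo --> (1 - alpha)%:E.
Proof.
move=> V Vhat G [phi [phi_incr phi_cont phi_ge0 phi0 avg_oP]] max_oP sup_oP.
case=> L GL.
have L0 : 0 <= L.
  by apply: le_trans (GL 0%N 1 0 _); rewrite ?divr_ge0// oner_neq0.
have GLip T x y : `|G T x - G T y| <= L * `|x - y|.
  have [->|xy] := eqVneq x y; first by rewrite !subrr normr0 mulr0.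
  by rewrite -ler_pdivrMr ?normr_gt0 ?subr_eq0// GL.
have mY T t : measurable_fun [set: Omega T] (Y T t) by exact: measurable_funPT.
have mX T t : measurable_fun [set: Omega T] (X T t) by exact: measurable_funPT.
have mV T t : measurable_fun [set: Omega T] (V T t).
  apply: (measurableT_comp hpsi).
  exact: (measurableT_comp hFstar (measurable_fun_pair (mY T t) (mX T t))).
have mVhat T t : measurable_fun [set: Omega T] (Vhat T t).
  apply: measurable_score => //; exact: measurable_augment.
have mdiff T t : measurable_fun [set: Omega T] (fun w => Vhat T t w - V T t w).
  exact: measurable_funB.
have mphi T t : measurable_fun [set: Omega T]
    (fun w => phi `|Vhat T t w - V T t w|).
  (* [phi] is continuous only on the half-line, so measurability is obtained there and composed with
     the absolute value, which maps into it. *)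
  have mphi0 :=
    subspace_continuous_measurable_fun (measurable_itv `[0, +oo[) phi_cont.
  apply: (measurable_comp (measurable_itv `[0, +oo[) _ mphi0).
    by move=> _ [w _ <-] /=; rewrite in_itv/= normr_ge0.
  apply: measurableT_comp => //; exact: normr_measurable.
have G01 T v : 0 <= G T v <= 1 by rewrite dist_fun_ge0 dist_fun_le1.
have cG T : continuous (G T) := lipschitz_cst_continuous (GLip T).
pose W T w := emp_cdf (Vhat T ^~ w) (Vhat T ord_max w).
have mW T : measurable_fun [set: Omega T] (W T) by exact: measurable_emp_cdf.
(* Coverage becomes the event [W T w < 1 - alpha] by complementing the p-value. *)
have -> : (fun T => P T [set w | full_conformal_set alpha psi (Fhat T)
      (fun s => Y T s w) (fun s => X T s w) (Y T ord_max w)]) =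
    (fun T => P T [set w | W T w < 1 - alpha]).
  apply/funext => T; congr (P T _); apply/seteqP.
  split => w; rewrite /= /full_conformal_set/= p_valueE /W.
    by rewrite ltrBrDl ltrBrDr addrC.
  by rewrite ltrBrDl ltrBrDr addrC.
case/andP: halpha => al0 al1.
apply: cvg_probability_sandwich;
  [by apply/andP; split; lra|by move=> T; exact: measure_ge0|].
move=> e e0 e1 e2.
(* Chosen so that [2 * (L + 1) * c = e / 3], which bounds the Lipschitz loss and stays meaningful
   for [L = 0]. *)
pose c := e / (6 * (L + 1)).
have c0 : 0 < c by rewrite divr_gt0// mulr_gt0//; lra.
have Lc : 2 * L * c <= e / 3.
  have -> : e / 3 = 2 * (L + 1) * c by rewrite /c; field; lra.
  by rewrite ler_wpM2r ?ltW//; lra.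
have phic0 : 0 < phi c by rewrite -phi0 phi_incr// in_itv/= ?lexx ?(ltW c0).
have e30 : 0 < e / 3 by rewrite divr_gt0.
(* One bad event per convergence hypothesis. The threshold of [B1] carries the factor [phi c] that
   Markov's inequality divides out, leaving a fraction at most [e / 3] of displaced indices. *)
pose B1 T := [set w | e / 3 * phi c <
  `|T.+1%:R^-1 * \sum_(t < T.+1) phi `|Vhat T t w - V T t w| |].
pose B2 T := [set w | c < `|Vhat T ord_max w - V T ord_max w|].
pose B3 T := [set w | e / 3 <
  `|sup [set `|emp_cdf (fun t => V T t w) v - G T v| | v in [set: R]]|].
have mB1 T : measurable (B1 T).
  apply: measurable_lt_cst.
  apply: measurableT_comp; first exact: normr_measurable.
  apply: measurable_funM; first exact: measurable_cst.
  exact: measurable_sum.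
have mB2 T : measurable (B2 T).
  apply: measurable_lt_cst.
  by apply: measurableT_comp => //; exact: normr_measurable.
have mB3 T : measurable (B3 T) by exact: measurable_sup_emp_cdf_dist.
exists (fun T => P T (B1 T) + P T (B2 T) + P T (B3 T))%E.
  rewrite -(adde0 0%E) -[X in (X + _)%E](adde0 0%E).
  apply: cvgeD => //; last exact: sup_oP.
  by apply: cvgeD => //; [apply: avg_oP; rewrite mulr_gt0|exact: max_oP].
move=> T; set B := B1 T `|` B2 T `|` B3 T.
have mB12 := measurableU _ _ (mB1 T) (mB2 T).
have mB : measurable B by exact: measurableU.
have PB : (P T B <= P T (B1 T) + P T (B2 T) + P T (B3 T))%E.
  apply: le_trans (measureU2 _ mB12 (mB3 T)) _.
  by rewrite leeD2r// measureU2.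
(* Off [B] the Lipschitz, uniform and counting errors are each at most [e / 3]. *)
have [||w Bw|lo up] := @probability_approx _ _ _ (P T) (V T ord_max) (W T) B
  (1 - alpha) e (mV T _) (mW T) mB (cG T) e0; [lra|lra| |].
- have nB1 : ~ B1 T w by move=> ?; apply: Bw; left; left.
  have nB2 : ~ B2 T w by move=> ?; apply: Bw; left; right.
  have nB3 : ~ B3 T w by move=> ?; apply: Bw; right.
  apply: le_trans (emp_cdf_close (V := V T ^~ w) (e := e / 3) (h := e / 3)
    (GLip T) L0 (ltW c0) _ _ _) _; last by lra.
  + move=> v; apply: le_trans (sup_emp_cdf_dist_ge _ v (G01 T)) _.
    by rewrite leNgt; apply/negP.
  + apply: le_trans (markov_mean _ phi_incr phi_ge0 c0 phic0) _.
    rewrite ler_pdivrMr// (le_trans (ler_norm _))// leNgt; exact/negP.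
  + by rewrite leNgt; apply/negP.
- by split; [apply: le_trans lo _|apply: le_trans up _]; rewrite leeD2l.
Qed.
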